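(* The set $\mathcal{M}(\mathbb{B})$ of slice regular M\''obius transformations on $\mathbb{B}$ does not admit a group structure such that the assignment $A\mapsto\mathcal{F}_A$ from $\mathrm{Sp}(1,1)$ onto $\mathcal{M}(\mathbb{B})$ is either a homomorphism or an anti-homomorphism of groups.
   Context: $\mathbb{H}$ denotes the quaternions and $\mathbb{B}=\{q\in\mathbb{H}: |q|<1\}$. $\mathrm{Sp}(1,1)=\{A\in M_2(\mathbb{H}): A^*I_{1,1}A=I_{1,1}\}$ with $I_{1,1}=\operatorname{diag}(1,-1)$. A function $f:\mathbb{B}\to\mathbb{H}$ is (left) slice regular if for every $I\in\mathbb{H}$ with $I^2=-1$ one has $\frac12\left(\frac{\partial}{\partial x}+I\frac{\partial}{\partial y}\right)f(x+Iy)=0$ whenever $x,y\in\mathbb{R}$, $x+yI\in\mathbb{B}$. Such functions have power series expansions $f(q)=\sum_n q^na_n$ on $\mathbb{B}$. For $f(q)=\sum q^na_n$ and $g(q)=\sum q^nb_n$, the $*$-product is $(f*g)(q)=\sum_n q^n\sum_{k=0}^n a_kb_{n-k}$; the regular conjugate is $f^c(q)=\sum q^n\overline{a_n}$; the symmetrization is $f^s=f*f^c$; the $*$-reciprocal is $f^{-*}(q)=f^s(q)^{-1}f^c(q)$ off the zero set of $f^s$. For $a,b\in\mathbb{H}$ let $l_{(a,b)}(q)=qa+b$. For $A=\begin{pmatrix}a&c\\ b&d\end{pmatrix}\in\mathrm{Sp}(1,1)$, the slice regular M\''obius transformation $\mathcal{F}_A:\mathbb{B}\to\mathbb{B}$ is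 $\mathcal{F}_A=l_{(c,d)}^{-*}*l_{(a,b)}$, written $\mathcal{F}_A(q)=(qc+d)^{-*}*(qa+b)$. Set $\mathcal{M}(\mathbb{B})=\{\mathcal{F}_A:A\in\mathrm{Sp}(1,1)\}$. (Each $\mathcal{F}_A$ is a well defined slice regular bijection of $\mathbb{B}$ onto itself.) An anti-homomorphism of groups is a map $\varphi:G\to H$ with $\varphi(gh)=\varphi(h)\varphi(g)$ for all $g,h\in G$. *)

(* Defs.v *)
From HB Require Import structures.
From mathcomp Require Import all_boot all_order all_algebra.
From mathcomp Require Import ring lra.
From mathcomp Require Import boolp classical_sets reals topology normedtype.
From mathcomp Require Import sequences.

Set Implicit Arguments.
Unset Strict Implicit.
Unset Printing Implicit Defensive.

Import Order.TTheory GRing.Theory Num.Theory.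
Import numFieldNormedType.Exports.

Local Open Scope classical_set_scope.
Local Open Scope ring_scope.

(* [Quat a b c d] stands for a + b i + c j + d k. *)
Record quat (R : Type) : Type := Quat { qre : R; qi : R; qj : R; qk : R }.

Section QuatChoice.
Variable R : Type.

Definition seq_of_quat (x : quat R) := [:: qre x; qi x; qj x; qk x].

Definition quat_of_seq (s : seq R) :=
  if s is [:: a; b; c; d] then Some (Quat a b c d) else None.

Lemma seq_of_quatK : pcancel seq_of_quat quat_of_seq.
Proof. by case. Qed.

End QuatChoice.

HB.instance Definition _ (R : eqType) := Equality.copy (quat R)
  (pcan_type (@seq_of_quatK R)).
HB.instance Definition _ (R : choiceType) := Choice.copy (quat R)
  (pcan_type (@seq_of_quatK R)).

Section QuatRing.
Variable R : realType.
Implicit Types x y z : quat R.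

Definition quat0 : quat R := Quat 0 0 0 0.
Definition quat1 : quat R := Quat 1 0 0 0.

Definition quat_opp x : quat R := Quat (- qre x) (- qi x) (- qj x) (- qk x).

Definition quat_add x y : quat R :=
  Quat (qre x + qre y) (qi x + qi y) (qj x + qj y) (qk x + qk y).

Definition quat_mul x y : quat R :=
  Quat (qre x * qre y - qi x * qi y - qj x * qj y - qk x * qk y)
       (qre x * qi y + qi x * qre y + qj x * qk y - qk x * qj y)
       (qre x * qj y - qi x * qk y + qj x * qre y + qk x * qi y)
       (qre x * qk y + qi x * qj y - qj x * qi y + qk x * qre y).

Definition quat_scale (r : R) x : quat R :=
  Quat (r * qre x) (r * qi x) (r * qj x) (r * qk x).

Definition quat_conj x : quat R := Quat (qre x) (- qi x) (- qj x) (- qk x).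

Definition quat_normsq x : R :=
  qre x ^+ 2 + qi x ^+ 2 + qj x ^+ 2 + qk x ^+ 2.

Definition quat_norm x : R := Num.sqrt (quat_normsq x).

Definition quat_inv x : quat R := quat_scale (quat_normsq x)^-1 (quat_conj x).

Lemma quat_addA : associative quat_add.
Proof. by case=> [? ? ? ?] [? ? ? ?] [? ? ? ?]; congr Quat => /=; ring. Qed.

Lemma quat_addC : commutative quat_add.
Proof. by case=> [? ? ? ?] [? ? ? ?]; congr Quat => /=; ring. Qed.

Lemma quat_add0 : left_id quat0 quat_add.
Proof. by case=> [? ? ? ?]; congr Quat => /=; ring. Qed.

Lemma quat_addN : left_inverse quat0 quat_opp quat_add.
Proof. by case=> [? ? ? ?]; congr Quat => /=; ring. Qed.

HB.instance Definition _ := GRing.isZmodule.Build (quat R)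
  quat_addA quat_addC quat_add0 quat_addN.

Lemma quat_mulA : associative quat_mul.
Proof. by case=> [? ? ? ?] [? ? ? ?] [? ? ? ?]; congr Quat => /=; ring. Qed.

Lemma quat_mul1x : left_id quat1 quat_mul.
Proof. by case=> [? ? ? ?]; congr Quat => /=; ring. Qed.

Lemma quat_mulx1 : right_id quat1 quat_mul.
Proof. by case=> [? ? ? ?]; congr Quat => /=; ring. Qed.

Lemma quat_mulDl : left_distributive quat_mul +%R.
Proof. by case=> [? ? ? ?] [? ? ? ?] [? ? ? ?]; congr Quat => /=; ring. Qed.

Lemma quat_mulDr : right_distributive quat_mul +%R.
Proof. by case=> [? ? ? ?] [? ? ? ?] [? ? ? ?]; congr Quat => /=; ring. Qed.

Lemma quat1_neq0 : quat1 != 0.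
Proof. by apply/eqP => -[] /eqP; rewrite oner_eq0. Qed.

HB.instance Definition _ := GRing.Zmodule_isNzRing.Build (quat R)
  quat_mulA quat_mul1x quat_mulx1 quat_mulDl quat_mulDr quat1_neq0.

Lemma quat_normsq_ge0 x : 0 <= quat_normsq x.
Proof. by rewrite /quat_normsq !addr_ge0 // sqr_ge0. Qed.

Lemma quat_normsq_eq0 x : quat_normsq x = 0 -> x = 0.
Proof.
case: x => a b c d /eqP; rewrite /quat_normsq /=.
rewrite !paddr_eq0 ?addr_ge0 ?sqr_ge0 // !sqrf_eq0.
by move=> /andP[/andP[/andP[/eqP -> /eqP ->] /eqP ->] /eqP ->].
Qed.

Lemma quat_mulVx : {in [pred x | x != 0 :> quat R], left_inverse 1 quat_inv *%R}.
Proof.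
move=> x; rewrite inE => x0.
have : quat_normsq x != 0 by apply: contra x0 => /eqP/quat_normsq_eq0 ->.
case: x {x0} => a b c d; rewrite /quat_normsq /= => n0.
by congr Quat; rewrite /= /quat_normsq /=; field.
Qed.

Lemma quat_mulxV : {in [pred x | x != 0 :> quat R], right_inverse 1 quat_inv *%R}.
Proof.
move=> x; rewrite inE => x0.
have : quat_normsq x != 0 by apply: contra x0 => /eqP/quat_normsq_eq0 ->.
case: x {x0} => a b c d; rewrite /quat_normsq /= => n0.
by congr Quat; rewrite /= /quat_normsq /=; field.
Qed.

Lemma quat_unitP x y : y * x = 1 /\ x * y = 1 -> [pred x | x != 0 :> quat R] x.
Proof.
case=> yx _; apply/eqP => x0; move: yx; rewrite x0 mulr0 => /esym/eqP.
by rewrite oner_eq0.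
Qed.

Lemma quat_inv0id :
  {in [predC [pred x | x != 0 :> quat R]], quat_inv =1 id}.
Proof.
move=> x; rewrite !inE negbK => /eqP ->.
by congr Quat; rewrite /= ?oppr0 mulr0.
Qed.

HB.instance Definition _ := GRing.NzRing_hasMulInverse.Build (quat R)
  quat_mulVx quat_mulxV quat_unitP quat_inv0id.

Lemma quat_scaleA (a b : R) x :
  quat_scale a (quat_scale b x) = quat_scale (a * b) x.
Proof. by case: x => *; congr Quat => /=; ring. Qed.

Lemma quat_scale1 : left_id 1 quat_scale.
Proof. by case=> *; congr Quat => /=; ring. Qed.

Lemma quat_scaleDr : right_distributive quat_scale +%R.
Proof. by move=> r [? ? ? ?] [? ? ? ?]; congr Quat => /=; ring. Qed.

Lemma quat_scaleDl x : {morph quat_scale^~ x : a b / a + b}.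
Proof. by case: x => ? ? ? ? r s; congr Quat => /=; ring. Qed.

HB.instance Definition _ := GRing.Zmodule_isLmodule.Build R (quat R)
  quat_scaleA quat_scale1 quat_scaleDr quat_scaleDl.

Lemma quat_scaleAl (r : R) x y : r *: (x * y) = r *: x * y.
Proof. by congr Quat => /=; ring. Qed.

HB.instance Definition _ := GRing.Lmodule_isLalgebra.Build R (quat R)
  quat_scaleAl.

Lemma quat_scaleAr (r : R) x y : r *: (x * y) = x * (r *: y).
Proof. by congr Quat => /=; ring. Qed.

HB.instance Definition _ := GRing.Lalgebra_isAlgebra.Build R (quat R)
  quat_scaleAr.

Lemma quat_normD x y : quat_norm (x + y) <= quat_norm x + quat_norm y.
Proof.
have sN z : 0 <= quat_norm z by exact: sqrtr_ge0.
have sE z : quat_norm z ^+ 2 = quat_normsq z.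
  by rewrite sqr_sqrtr // quat_normsq_ge0.
rewrite -(ler_pXn2r (ltn0Sn 1)) ?nnegrE ?addr_ge0 // sqrrD !sE.
pose p := qre x * qre y + qi x * qi y + qj x * qj y + qk x * qk y.
have -> : quat_normsq (x + y) = quat_normsq x + p *+ 2 + quat_normsq y.
  by rewrite /quat_normsq /p /=; ring.
rewrite lerD2r lerD2l lerMn2r /=.
apply: (le_trans (ler_norm p)).
rewrite -(ler_pXn2r (ltn0Sn 1)) ?nnegrE ?mulr_ge0 // exprMn !sE.
rewrite real_normK ?num_real //.
have -> : quat_normsq x * quat_normsq y = p ^+ 2 +
   ((qre x * qi y - qi x * qre y) ^+ 2 + (qre x * qj y - qj x * qre y) ^+ 2 +
    (qre x * qk y - qk x * qre y) ^+ 2 + (qi x * qj y - qj x * qi y) ^+ 2 +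
    (qi x * qk y - qk x * qi y) ^+ 2 + (qj x * qk y - qk x * qj y) ^+ 2).
  by rewrite /quat_normsq /p /=; ring.
by rewrite lerDl !addr_ge0 // sqr_ge0.
Qed.

Lemma quat_normZ (r : R) x : quat_norm (r *: x) = `|r| * quat_norm x.
Proof.
rewrite /quat_norm -sqrtr_sqr -sqrtrM ?sqr_ge0 //; congr Num.sqrt.
by rewrite /quat_normsq /=; ring.
Qed.

Lemma quat_norm0_eq0 x : quat_norm x = 0 -> x = 0.
Proof.
move=> /eqP; rewrite sqrtr_eq0 => n0; apply: quat_normsq_eq0.
by apply/le_anti; rewrite n0 quat_normsq_ge0.
Qed.

HB.instance Definition _ := Lmodule_isNormed.Build R (quat R)
  quat_normD quat_normZ quat_norm0_eq0.

Lemma quat_conjD x y : quat_conj (x + y) = quat_conj x + quat_conj y.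
Proof. by congr Quat => /=; ring. Qed.

Lemma quat_conjM x y : quat_conj (x * y) = quat_conj y * quat_conj x.
Proof. by congr Quat => /=; ring. Qed.

Lemma quat_conjK : involutive quat_conj.
Proof. by case=> *; congr Quat => /=; ring. Qed.

End QuatRing.

Section PowerSeries.
Variable R : realType.

Record qball : Type := QBall { qball_val :> quat R; _ : `|qball_val| < 1 }.

Implicit Types (f g : qball -> quat R) (a b : nat -> quat R).

Definition psum a (q : qball) : quat R :=
  limn (series (fun n => (q : quat R) ^+ n * a n)).

Definition has_expansion f a : Prop := forall q : qball,
  series (fun n => (q : quat R) ^+ n * a n) @ \oo --> f q.

(* Chosen classically: the expansion of f on the ball is unique when it exists,
   which is the case for every slice regular f; otherwise the value is junk. *)
Definition coefs f : nat -> quat R := get [set a | has_expansion f a].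

Definition star f g : qball -> quat R :=
  psum (fun n => \sum_(k < n.+1) coefs f k * coefs g (n - k)%N).

Definition regconj f : qball -> quat R := psum (fun n => quat_conj (coefs f n)).

Definition symm f : qball -> quat R := star f (regconj f).

(* [_^-1] is total with 0^-1 = 0, so this is meaningful off the zeros of
   [symm f]. *)
Definition starV f : qball -> quat R := fun q => (symm f q)^-1 * regconj f q.

Definition lfun (a b : quat R) : qball -> quat R := fun q => (q : quat R) * a + b.

End PowerSeries.

Section Sp11.
Variable R : realType.
Local Notation M2 := 'M[quat R]_2.
Implicit Types A B : M2.

Definition I11 : M2 := diag_mx (\row_i (-1) ^+ i).

Definition adjmx A : M2 := map_mx (@quat_conj R) A^T.

Definition sp11_pred : pred M2 := fun A => adjmx A *m I11 *m A == I11.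

Record sp11 : Type := Sp11 { sp11_val :> M2; sp11P : sp11_pred sp11_val }.

HB.instance Definition _ := [isSub for sp11_val].
HB.instance Definition _ := [Choice of sp11 by <:].

Lemma mulmx2E A B i j : (A *m B) i j = A i 0 * B 0 j + A i 1 * B 1 j.
Proof.
rewrite mxE big_ord_recl big_ord1.
by congr (_ + A i _ * B _ j); apply/val_inj.
Qed.

Lemma mx2P A B : A 0 0 = B 0 0 -> A 0 1 = B 0 1 -> A 1 0 = B 1 0 ->
  A 1 1 = B 1 1 -> A = B.
Proof.
move=> h00 h01 h10 h11; apply/matrixP => i j.
have ord2 (k : 'I_2) : k = 0 \/ k = 1.
  by case: k => [[|[|//]]] ?; [left|right]; apply/val_inj.
by have [-> | ->] := ord2 i; have [-> | ->] := ord2 j.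
Qed.

Lemma quat_conj0 : quat_conj 0 = 0 :> quat R.
Proof. by congr Quat; rewrite /= ?oppr0. Qed.

Lemma quat_conj1 : quat_conj 1 = 1 :> quat R.
Proof. by congr Quat; rewrite /= ?oppr0. Qed.

Lemma quat_conjN (x : quat R) : quat_conj (- x) = - quat_conj x.
Proof. by congr Quat. Qed.

Lemma adjmxE A i j : adjmx A i j = quat_conj (A j i).
Proof. by rewrite !mxE. Qed.

Lemma I11E : (I11 0 0 = 1) * (I11 0 1 = 0) * (I11 1 0 = 0) * (I11 1 1 = -1).
Proof. by rewrite /I11 !mxE /= expr0 expr1. Qed.

Lemma I11sq : I11 *m I11 = 1%:M.
Proof.
apply: mx2P; rewrite mulmx2E !I11E !mxE /= ?mulrNN;
  by rewrite !(mulr1, mulr0, mul0r) ?add0r ?addr0.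
Qed.

Lemma adjmxM A B : adjmx (A *m B) = adjmx B *m adjmx A.
Proof.
by apply: mx2P; rewrite adjmxE !mulmx2E quat_conjD !quat_conjM !adjmxE.
Qed.

Lemma adjmxI : adjmx I11 = I11.
Proof.
by apply: mx2P; rewrite adjmxE !I11E ?quat_conjN ?quat_conj0 ?quat_conj1.
Qed.

Lemma adjmxK : involutive adjmx.
Proof. by move=> A; apply/matrixP => i j; rewrite !adjmxE quat_conjK. Qed.

Lemma adjmx1 : adjmx 1%:M = 1%:M.
Proof. by apply: mx2P; rewrite adjmxE !mxE /= ?quat_conj0 ?quat_conj1. Qed.


Lemma quat_mulxC (x : quat R) : x * quat_conj x = (quat_normsq x)%:A.
Proof. by congr Quat; rewrite /quat_normsq /=; ring. Qed.

Lemma quat_mulCx (x : quat R) : quat_conj x * x = (quat_normsq x)%:A.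
Proof. by congr Quat; rewrite /quat_normsq /=; ring. Qed.

Lemma quat_normsqM (x y : quat R) :
  quat_normsq (x * y) = quat_normsq x * quat_normsq y.
Proof. by rewrite /quat_normsq /=; ring. Qed.

Lemma quat_normsqC (x : quat R) : quat_normsq (quat_conj x) = quat_normsq x.
Proof. by rewrite /quat_normsq /=; ring. Qed.

Lemma quat_scale1_inj (r s : R) : r *: (1 : quat R) = s *: 1 -> r = s.
Proof. by move=> /(congr1 (@qre R)) /=; rewrite !mulr1. Qed.

(* Over a non-commutative ring, the passage from A^* I A = I to A I A^* = I is
   not provided by the theory of [unitmx]. *)
Lemma sp11_adj A : sp11_pred A -> A *m I11 *m adjmx A = I11.
Proof.
move=> /eqP AI.
have E i j : quat_conj (A 0 i) * A 0 j - quat_conj (A 1 i) * A 1 j = I11 i j.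
  rewrite -AI !mulmx2E !I11E !adjmxE.
  by rewrite !(mulr1, mulr0, addr0, add0r) mulrN1 mulNr.
set n := @quat_normsq R.
have /quat_scale1_inj ab : (n (A 0 0) - n (A 1 0)) *: (1 : quat R) = 1 *: 1.
  by rewrite scalerBl -!quat_mulCx E I11E scale1r.
have /quat_scale1_inj cd : (n (A 0 1) - n (A 1 1)) *: (1 : quat R) = (- 1) *: 1.
  by rewrite scalerBl -!quat_mulCx E I11E scaleN1r.
have ac : quat_conj (A 0 0) * A 0 1 = quat_conj (A 1 0) * A 1 1.
  by apply/eqP; rewrite -subr_eq0 E I11E.
have := congr1 n ac; rewrite /n !quat_normsqM !quat_normsqC -/n => nn.
have bc : n (A 1 0) = n (A 0 1) by nra.
have ad : n (A 0 0) = n (A 1 1) by lra.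
have d0 : n (A 1 1) != 0.
  by rewrite gt_eqF //; have := quat_normsq_ge0 (A 1 0); rewrite -/(n _); lra.
have cd_ab : A 0 1 * quat_conj (A 1 1) = A 0 0 * quat_conj (A 1 0).
  apply: (scalerI d0).
  rewrite -{1}ad scalerAl -[in LHS](mul1r (A 0 1)) scalerAl.
  rewrite -quat_mulxC -(mulrA (A 0 0)) ac -!mulrA quat_mulxC.
  by rewrite -!scalerAr mulr1.
have F i j : A i 0 * quat_conj (A j 0) - A i 1 * quat_conj (A j 1) = I11 i j ->
    (A *m I11 *m adjmx A) i j = I11 i j.
  move=> <-; rewrite !mulmx2E !I11E !adjmxE.
  by rewrite !(mulr1, mulr0, addr0, add0r) mulrN1 mulNr.
apply: mx2P; apply: F; rewrite I11E.
- by rewrite !quat_mulxC -scalerBl -/n -bc ab scale1r.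
- by rewrite cd_ab subrr.
- apply: (can_inj (@quat_conjK R)).
  by rewrite quat_conjD quat_conjN !quat_conjM !quat_conjK cd_ab subrr quat_conj0.
- by rewrite !quat_mulxC -scalerBl -/n bc cd scaleN1r.
Qed.

Lemma sp11_mul_subproof (A B : sp11) : sp11_pred (A *m B).
Proof.
rewrite /sp11_pred adjmxM -!mulmxA (mulmxA I11) (mulmxA (adjmx A)).
rewrite (mulmxA (adjmx A)) (eqP (sp11P A)) mulmxA.
exact: sp11P.
Qed.

Lemma sp11_one_subproof : sp11_pred 1%:M.
Proof. by rewrite /sp11_pred adjmx1 mul1mx mulmx1. Qed.

Lemma sp11_inv_subproof (A : sp11) : sp11_pred (I11 *m adjmx A *m I11).
Proof.
rewrite /sp11_pred !adjmxM adjmxI adjmxK.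
rewrite -!mulmxA (mulmxA I11 I11) I11sq mul1mx.
rewrite (mulmxA I11 (adjmx A)) (mulmxA A) (mulmxA A) sp11_adj ?sp11P //.
by rewrite I11sq mulmx1.
Qed.

Definition sp11_mul (A B : sp11) : sp11 := Sp11 (sp11_mul_subproof A B).
Definition sp11_one : sp11 := Sp11 sp11_one_subproof.
Definition sp11_inv (A : sp11) : sp11 := Sp11 (sp11_inv_subproof A).

Lemma sp11_mulA : associative sp11_mul.
Proof. by move=> A B C; apply/val_inj; rewrite /= mulmxA. Qed.

Lemma sp11_mul1 : left_id sp11_one sp11_mul.
Proof. by move=> A; apply/val_inj; rewrite /= mul1mx. Qed.

Lemma sp11_mulr1 : right_id sp11_one sp11_mul.
Proof. by move=> A; apply/val_inj; rewrite /= mulmx1. Qed.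

Lemma sp11_mulV : left_inverse sp11_one sp11_inv sp11_mul.
Proof.
move=> A; apply/val_inj => /=.
by rewrite -!mulmxA (mulmxA (adjmx A)) (eqP (sp11P A)) I11sq.
Qed.

Lemma sp11_mulrV : right_inverse sp11_one sp11_inv sp11_mul.
Proof.
by move=> A; apply/val_inj; rewrite /= !mulmxA sp11_adj ?sp11P // I11sq.
Qed.

HB.instance Definition _ := isGroup.Build sp11
  sp11_mulA sp11_mul1 sp11_mulr1 sp11_mulV sp11_mulrV.

End Sp11.

Section Moebius.
Variable R : realType.

(* A = (a c; b d) with a, b in the first column, so that
   F_A(q) = (q c + d)^{-*} * (q a + b). *)
Definition moebius (A : sp11 R) : qball R -> quat R :=
  star (starV (lfun (A 0 1) (A 1 1))) (lfun (A 0 0) (A 1 0)).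

(* Functions are valued in all of [quat R]; that the maps [moebius A] send the
   ball into itself is a theorem and is not built into the type. *)
Definition moebius_set : Type := {f | exists A, f = moebius A}.

Definition to_moebius_set (A : sp11 R) : moebius_set :=
  exist _ (moebius A) (ex_intro _ A erefl).

End Moebius.

(* The data and laws of a [groupType] with carrier T. [groupType] bundles a
   [choiceType] structure, which classically exists on every type. *)
Definition group_structure (T : Type) : Type := Group.axioms_ T.

Definition is_hom (G H : groupType) (f : G -> H) : Prop :=
  forall x y, f (x * y)%g = (f x * f y)%g.

Definition is_antihom (G H : groupType) (f : G -> H) : Prop :=
  forall x y, f (x * y)%g = (f y * f x)%g.

(* Main.v *)
Require Import Defs.
From mathcomp Require Import all_boot all_order all_algebra reals.
From mathcomp Require Import lra.
From mathcomp Require Import boolp classical_sets topology normedtype sequences.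

(** Both a homomorphism and an anti-homomorphism would make F_A depend only
on the coset of A modulo the fibre of F over F_1, on either side: if F_N = F_1
then F_(A N) = F_(A 1) = F_A for every A. A unit quaternion u, viewed as the
scalar matrix diag(u, u), lies in that fibre: multiplying A by u on the left
turns l_(c,d) into u * l_(c,d) and l_(a,b) into u * l_(a,b), and the two factors u
meet and cancel in the *-product of the reciprocal of the first by the second
([moebius_scalar_mull]). But multiplying A by u on the right conjugates the
value F_A(0) = d^-1 b to u^-1 (d^-1 b) u, which moves it as soon as u does not
commute with d^-1 b. The hyperbolic matrix [boost] has d^-1 b = -(3/5) i, so
u = j contradicts F_(A u) = F_A ([moebius_boost_mulr]).

Since *-products are computed from the coefficients of the factors, what
carries the argument is the power series of the reciprocal of l_(c,d),
namely the sum of the q^n (- d^-1 c)^n d^-1. That coefficients are determined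
by the function is [has_expansion_inj]: on real q the powers of q are scalars,
so it reduces to power series in a real variable ([powser_eq0]). That this
series converges on the ball to the pointwise quotient defining the reciprocal
is [has_expansion_starV_lfun]: the symmetrization of l_(c,d), having real
coefficients, can be multiplied into the partial sums, and the products
telescope ([symm_lfun_series]). *)

Set Implicit Arguments.
Unset Strict Implicit.
Unset Printing Implicit Defensive.

Import Order.TTheory GRing.Theory Num.Theory.
Import numFieldNormedType.Exports.

Local Open Scope classical_set_scope.
Local Open Scope ring_scope.

(** * Power series in a real variable *)

Section RealPowerSeries.
Variable R : realType.

(** Convergence at t = 1/2 bounds [a n] by a multiple of 2^n, so for small t
the tail of the series after its constant term is O(t). The origin is excluded
from the hypothesis so that it survives the division by t in [powser_eq0]. *)
Lemma powser_coef0_eq0 (V : normedModType R) (a : nat -> V) :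
  (forall t : R, 0 < t < 1 -> series (fun n => t ^+ n *: a n) @ \oo --> (0 : V)) ->
  a 0%N = 0.
Proof.
move=> a_cvg; set h : R := 2^-1.
have h0 : 0 < h by rewrite invr_gt0.
have h2 : h + h = 1 by rewrite /h; lra.
have [M M0 aM] : exists2 M : R, 0 < M & forall n, `|a n| * h ^+ n <= M.
  have /cvgP/cvg_series_cvg_0/cvgP/cvg_seq_bounded :
      series (fun n => h ^+ n *: a n) @ \oo --> (0 : V).
    by apply: a_cvg; lra.
  move=> /ex_strict_bound_gt0[M M0 aM]; exists M => // n.
  have := aM n I; rewrite /= normrZ ger0_norm ?exprn_ge0 ?(ltW h0)// mulrC.
  exact: ltW.
have bound (t : R) : 0 < t <= h * h -> `|a 0%N| <= 4 * M * t.
  move=> t_range.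
  (* With r = 2 t <= 1/2 the k-th term is at most M r^k <= 2 M t / 2^(k-1);
     the right-hand side is the sum of this geometric bound for 1 <= k <= n. *)
  have St n : `|series (fun n => t ^+ n *: a n) n.+1 - a 0%N| <=
              4 * M * t * (1 - h ^+ n).
    elim: n => [|n IHn].
      by rewrite seriesSr /series /= big_geq// expr0 scale1r add0r !subrr normr0 mulr0.
    rewrite seriesSr addrAC (le_trans (ler_normD _ _))//.
    have tn : `|t ^+ n.+1 *: a n.+1| <= 4 * M * t * (h ^+ n * h).
      rewrite normrZ ger0_norm ?exprn_ge0//; last by lra.
      have -> : t ^+ n.+1 * `|a n.+1| = (2 * t) ^+ n.+1 * (`|a n.+1| * h ^+ n.+1).
        by rewrite mulrCA mulrC -exprMn -mulrA (mulrC t) mulrA /h mulfV ?mul1r// ?pnatr_eq0.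
      have -> : 4 * M * t * (h ^+ n * h) = (2 * t * h ^+ n) * M by rewrite /h; lra.
      apply: ler_pM => //; first by rewrite exprn_ge0//; lra.
        by rewrite mulr_ge0// exprn_ge0// ltW.
      rewrite exprS ler_wpM2l//; first by lra.
      have th : h * h = h / 2 by [].
      by apply: lerXn2r; rewrite ?nnegrE; lra.
    rewrite (le_trans (lerD IHn tn))// exprSr.
    by rewrite -mulrDr ler_wpM2l ?mulr_ge0//; nra.
  have /cvg_norm cvgN : (fun n => a 0%N - series (fun n => t ^+ n *: a n) n.+1) @ \oo -->
      a 0%N - 0.
    apply: cvgB; first exact: cvg_cst.
    by rewrite (cvg_shiftS (series (fun n => t ^+ n *: a n))); apply: a_cvg; nra.
  rewrite -[a 0%N]subr0.
  rewrite -(cvg_lim (@Rhausdorff R) cvgN).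
  apply: limr_le; first by apply/cvg_ex; exists `|a 0%N - 0|.
  near=> n; rewrite distrC (le_trans (St n))//.
  rewrite ler_piMr//; first by rewrite !mulr_ge0//; lra.
  by rewrite lerBlDr lerDl exprn_ge0// ltW.
apply/eqP/negPn/negP; rewrite -normr_gt0 => a0.
(* Any t below a 4 M-th of [`|a 0|] contradicts [bound]; 8 leaves strict room. *)
pose t := Num.min (h * h) (`|a 0%N| / (8 * M)).
have M8 : 0 < 8 * M by lra.
have t0 : 0 < t by rewrite lt_min !mulr_gt0// invr_gt0.
have /bound : 0 < t <= h * h by rewrite t0 ge_min lexx.
have : t * (8 * M) <= `|a 0%N| by rewrite -ler_pdivlMr// ge_min lexx orbT.
nra.
Unshelve. all: by end_near.
Qed.

Lemma powser_eq0 (V : normedModType R) (a : nat -> V) :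
  (forall t : R, 0 < t < 1 -> series (fun n => t ^+ n *: a n) @ \oo --> (0 : V)) ->
  forall n, a n = 0.
Proof.
move=> a_cvg n; elim: n a a_cvg => [|n IHn] a a_cvg; first exact: powser_coef0_eq0.
apply: (IHn (fun k => a k.+1)) => t t01.
have a0 := powser_coef0_eq0 a_cvg.
have -> : series (fun k => t ^+ k *: a k.+1) =
          (fun m => t^-1 *: series (fun k => t ^+ k *: a k) m.+1).
  apply/funext => m; rewrite /series /= big_nat_recl// a0 scaler0 add0r.
  rewrite scaler_sumr; apply: eq_bigr => k _.
  by rewrite scalerA exprS mulKf//; lra.
rewrite -(scaler0 V t^-1); apply: cvgZl_tmp.
by rewrite (cvg_shiftS (series (fun n => t ^+ n *: a n))); apply: a_cvg.
Qed.

Lemma geometric_dist_cvg (V : normedModType R) (u : nat -> V) l (K r : R) : 0 <= r < 1 ->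
  (forall n, `|u n.+1 - l| <= K * r ^+ n.+1) -> u @ \oo --> l.
Proof.
move=> /andP[r0 r1] ul; rewrite -(cvg_shiftS u); apply/subr_cvg0/norm_cvg0P.
have ge0 : (fun n => K * r ^+ n.+1) @ \oo --> (0 : R).
  rewrite (cvg_shiftS (fun n => K * r ^+ n)).
  by apply: cvg_geometric; rewrite ger0_norm.
apply: (squeeze_cvgr (f := fun=> 0) _ _ ge0); last exact: cvg_cst.
by near=> n; rewrite normr_ge0 ul.
Unshelve. all: by end_near.
Qed.

End RealPowerSeries.

(** * Expansions of linear functions and of their reciprocals *)

Section Expansions.
Variable R : realType.
Implicit Types (a b c d x y : quat R) (f : qball R -> quat R).

Lemma quat_normM x y : `|x * y| = `|x| * `|y|.
Proof.
rewrite /Num.norm /= /quat_norm -sqrtrM ?quat_normsq_ge0//.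
by rewrite quat_normsqM.
Qed.

Lemma quat_norm_conj x : `|quat_conj x| = `|x|.
Proof. by rewrite /Num.norm /= /quat_norm quat_normsqC. Qed.

Lemma quat_norm1 : `|1 : quat R| = 1.
Proof.
by rewrite /Num.norm /= /quat_norm /quat_normsq /= expr1n !expr0n !addr0 sqrtr1.
Qed.

Lemma quat_normX x n : `|x ^+ n| = `|x| ^+ n.
Proof. by elim: n => [|n IHn]; rewrite ?quat_norm1// !exprS quat_normM IHn. Qed.

(** It suffices to test on real points of the ball, where the powers of q act
on the coefficients as scalars. *)
Lemma has_expansion_inj f (a b : nat -> quat R) :
  has_expansion f a -> has_expansion f b -> a = b.
Proof.
move=> fa fb; apply/funext => n; apply/eqP; rewrite -subr_eq0; apply/eqP.
move: n; apply: (@powser_eq0 R (quat R) (fun n => a n - b n)) => t t01.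
have tq : `|t%:A : quat R| < 1.
  by rewrite normrZ quat_norm1 mulr1 ger0_norm; lra.
have -> : series (fun k => t ^+ k *: (a k - b k)) =
    (fun m => series (fun k => (QBall tq : quat R) ^+ k * a k) m -
              series (fun k => (QBall tq : quat R) ^+ k * b k) m).
  apply/funext => m; rewrite /series /= -sumrB; apply: eq_bigr => k _.
  by rewrite exprZn expr1n !mulr_algl scalerBr.
rewrite -(subrr (f (QBall tq))); exact: cvgB (fa _) (fb _).
Qed.

Lemma coefs_eq f (a : nat -> quat R) : has_expansion f a -> coefs f = a.
Proof.
move=> fa; apply: (has_expansion_inj (f := f)) => //.
exact: (@getI _ [set a | has_expansion f a] a fa).
Qed.

Lemma series_fin (a : nat -> quat R) N (q : qball R) :
  (forall n, (N <= n)%N -> a n = 0) ->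
  series (fun n => (q : quat R) ^+ n * a n) @ \oo -->
  \sum_(0 <= k < N) (q : quat R) ^+ k * a k.
Proof.
move=> aN; apply: cvg_near_cst; near=> n.
have Nn : (N <= n)%N by near: n; exists N.
rewrite /series /= (big_cat_nat _ (n := N))//= [X in _ + X]big_nat_cond.
rewrite [X in _ + X]big1 ?addr0//.
by move=> k /andP[/andP[Nk _] _]; rewrite aN ?mulr0.
Unshelve. all: by end_near.
Qed.

Lemma psum_cvg (a : nat -> quat R) (q : qball R) l :
  series (fun n => (q : quat R) ^+ n * a n) @ \oo --> l -> psum a q = l.
Proof. by apply: cvg_lim; apply: norm_hausdorff. Qed.

Definition lcoef a b (n : nat) : quat R :=
  if n is m.+1 then (if m is 0%N then a else 0) else b.

Lemma lcoef_ge2 a b n : (2 <= n)%N -> lcoef a b n = 0.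
Proof. by case: n => [|[|]]. Qed.

Lemma coefs_lfun a b : coefs (lfun a b) = lcoef a b.
Proof.
apply: coefs_eq => q.
have -> : lfun a b q = \sum_(0 <= k < 2) (q : quat R) ^+ k * lcoef a b k.
  by rewrite !big_nat_recr//= big_geq// add0r expr0 expr1 mul1r addrC.
exact/series_fin/lcoef_ge2.
Qed.

Lemma regconj_lfun a b : regconj (lfun a b) = lfun (quat_conj a) (quat_conj b).
Proof.
apply/funext => q; rewrite /regconj coefs_lfun.
rewrite (psum_cvg (@series_fin _ 2 q _)); last first.
  by move=> n n2; rewrite lcoef_ge2// quat_conj0.
by rewrite !big_nat_recr//= big_geq// add0r expr0 expr1 mul1r addrC.
Qed.

Lemma symm_lfun c d q :
  symm (lfun c d) q = d * quat_conj d
    + (q : quat R) * (d * quat_conj c + c * quat_conj d)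
    + (q : quat R) ^+ 2 * (c * quat_conj c).
Proof.
rewrite /symm regconj_lfun /star !coefs_lfun.
rewrite (psum_cvg (@series_fin _ 3 q _)).
  rewrite !big_nat_recr//= big_geq// add0r !big_ord_recr !big_ord0 /=.
  by rewrite !add0r expr0 mul1r expr1 mulr0 mul0r add0r addr0.
move=> n n3; rewrite big1// => k _.
have [k2|k2] := leqP 2 k; first by rewrite lcoef_ge2// mul0r.
by rewrite (lcoef_ge2 _ _ (leq_sub n3 (k2 : (k <= 1)%N))) mulr0.
Qed.

Lemma quat_polar x y :
  x * quat_conj y + y * quat_conj x =
  quat_conj y * x + quat_conj x * y.
Proof. by congr Quat => /=; lra. Qed.

Lemma quat_polar_real x y :
  quat_conj y * x + quat_conj x * y =
  ((qre x * qre y + qi x * qi y + qj x * qj y + qk x * qk y) *+ 2)%:A.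
Proof. by congr Quat => /=; rewrite mulr2n; lra. Qed.

(** The symmetrization of [lfun c d] has real coefficients, which commute with
the powers of q and can be rewritten so that d and c act on x first: the right
side lists the coefficients of l^c * l * (q^n x) for l = [lfun c d]. *)
Lemma symm_lfun_mul c d (q : qball R) n x :
  symm (lfun c d) q * ((q : quat R) ^+ n * x) =
    (q : quat R) ^+ n * (quat_conj d * (d * x))
  + (q : quat R) ^+ n.+1 * (quat_conj c * (d * x) + quat_conj d * (c * x))
  + (q : quat R) ^+ n.+2 * (quat_conj c * (c * x)).
Proof.
rewrite !(mulrA (quat_conj _)) !quat_mulCx -mulrDl.
rewrite symm_lfun quat_polar quat_polar_real !quat_mulxC.
rewrite !mulr_algr !mulr_algl !mulrDl !mulr_algl -!scalerAl -!scalerAr.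
by rewrite !mulrA -exprS -exprD.
Qed.

(** The coefficients e_n of the *-inverse of q c + d, that is the solution of
d e_0 = 1 and d e_(n+1) + c e_n = 0. *)
Definition starV_coef c d n : quat R := (- (d^-1 * c)) ^+ n * d^-1.

Lemma starV_coefS c d n : d != 0 ->
  d * starV_coef c d n.+1 = - (c * starV_coef c d n).
Proof.
by move=> d0; rewrite /starV_coef exprS !mulNr !mulrN !mulrA divrr// mul1r.
Qed.

(** Multiplying the truncated series of the *-inverse by [lfun c d] leaves
1 + q^(n+1) c e_n, by the recurrence on the e_n; multiplying further by the
regular conjugate gives the two boundary terms. *)
Lemma symm_lfun_series c d (q : qball R) n : d != 0 ->
  symm (lfun c d) q * series (fun k => (q : quat R) ^+ k * starV_coef c d k) n.+1 =
  regconj (lfun c d) q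
  + ((q : quat R) ^+ n.+1 * (quat_conj d * (c * starV_coef c d n))
  + (q : quat R) ^+ n.+2 * (quat_conj c * (c * starV_coef c d n))).
Proof.
move=> d0; have dV : d * starV_coef c d 0 = 1 by rewrite /starV_coef expr0 mul1r divrr.
rewrite regconj_lfun; have -> : lfun (quat_conj c) (quat_conj d) q =
  (q : quat R) * quat_conj c + quat_conj d by [].
elim: n => [|n IHn].
  rewrite seriesSr /series /= big_geq// add0r symm_lfun_mul dV !mulr1 expr0 mul1r.
  by rewrite mulrDr !addrA (addrC (quat_conj d)).
rewrite seriesSr mulrDr IHn symm_lfun_mul starV_coefS// !mulrN mulrDr mulrN.
by rewrite -!addrA; congr (_ + _); congr (_ + _); rewrite addrCA !addNKr.
Qed.

(** The boundary terms of [symm_lfun_series] decay geometrically because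
[`|d^-1 * c| <= 1] keeps the coefficients bounded. So the partial sums times
the symmetrization tend to the regular conjugate, and it remains to divide. *)
Lemma has_expansion_starV_lfun c d : d != 0 -> `|c| <= `|d| ->
  has_expansion (starV (lfun c d)) (starV_coef c d).
Proof.
move=> d0 cd q; have q1 : 0 <= `|(q : quat R)| < 1.
  by case: q => q /= ->; rewrite normr_ge0.
have dn : 0 < `|d| by rewrite normr_gt0.
have dVn : `|d^-1| * `|d| = 1 by rewrite -quat_normM mulVr ?quat_norm1.
have coef_le n : `|starV_coef c d n| <= `|d^-1|.
  rewrite quat_normM ler_piMl// quat_normX normrN exprn_ile1// quat_normM.
  by rewrite -dVn ler_wpM2l.
pose K := `|d| * (`|c| * `|d^-1|) + `|c| * (`|c| * `|d^-1|).
pose rem n := (q : quat R) ^+ n.+1 * (quat_conj d * (c * starV_coef c d n))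
  + (q : quat R) ^+ n.+2 * (quat_conj c * (c * starV_coef c d n)).
have rem_le n : `|rem n| <= K * `|(q : quat R)| ^+ n.+1.
  rewrite /rem; move: (starV_coef c d n) (coef_le n) => e e_le.
  rewrite (le_trans (ler_normD _ _))// mulrC /K mulrDr lerD//.
    rewrite !quat_normM quat_norm_conj quat_normX.
    by rewrite !ler_wpM2l ?exprn_ge0.
  rewrite quat_normM quat_normX !quat_normM quat_norm_conj exprS ler_pM ?mulr_ge0 ?exprn_ge0//.
    by rewrite ler_piMl ?exprn_ge0// ltW//; case/andP: q1.
  by rewrite !ler_wpM2l.
have symmE n := symm_lfun_series c q n d0.
(* A zero q of the symmetrization would, in the limit, be a zero of the
   regular conjugate q c^* + d^*, forcing |d| = |q| |c| < |d|. *)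
have symm_neq0 : symm (lfun c d) q != 0.
  apply/eqP => symm0; have conj0 : regconj (lfun c d) q = 0.
    have cst0 : (fun=> 0 : quat R) @ \oo --> regconj (lfun c d) q.
      apply: (geometric_dist_cvg (K := K) q1) => n.
      have := symmE n; rewrite symm0 mul0r -/(rem n) => /esym/eqP.
      by rewrite addr_eq0 => /eqP ->; rewrite sub0r opprK.
    by apply: (cvg_unique (@norm_hausdorff R (quat R)) cst0); exact: cvg_cst.
  move: conj0; rewrite regconj_lfun /lfun addrC => /eqP; rewrite addr_eq0.
  move=> /eqP/(congr1 Num.norm); rewrite normrN quat_normM !quat_norm_conj => dqc.
  by case/andP: q1 => q0 q1; nra.
apply: (geometric_dist_cvg (K := `|(symm (lfun c d) q)^-1| * K) q1) => n.
have -> : series (fun k => (q : quat R) ^+ k * starV_coef c d k) n.+1 =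
    (symm (lfun c d) q)^-1 * (regconj (lfun c d) q + rem n).
  by rewrite -symmE mulrA mulVr ?mul1r.
by rewrite mulrDr addrC addKr quat_normM -mulrA ler_wpM2l.
Qed.

End Expansions.

(** * Slice regular Moebius transformations *)

Section Moebius.
Variable R : realType.
Implicit Types (A : sp11 R) (u : quat R).

(** The lower right entry of A^* I A = I says |c|^2 - |d|^2 = -1. *)
Lemma sp11_lt A : `|A 0 1| < `|A 1 1|.
Proof.
have := congr1 (fun M : 'M[quat R]_2 => M 1 1) (eqP (sp11P A)).
rewrite /= !mulmx2E !I11E !adjmxE !(mulr1, mulr0, addr0, add0r) mulrN1 mulNr.
rewrite !quat_mulCx -scalerBl -(scaleN1r (1 : quat R)) => /quat_scale1_inj n01.
rewrite /Num.norm /= /quat_norm ltr_sqrt; first by lra.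
by have := quat_normsq_ge0 (A 0 1); lra.
Qed.

Lemma sp11_neq0 A : A 1 1 != 0.
Proof. by rewrite -normr_gt0 (le_lt_trans _ (sp11_lt A)). Qed.

Definition moebius_coef A n : quat R :=
  \sum_(k < n.+1) starV_coef (A 0 1) (A 1 1) k * lcoef (A 0 0) (A 1 0) (n - k)%N.

Lemma moebiusE A : moebius A = psum (moebius_coef A).
Proof.
rewrite /moebius /star coefs_lfun.
by rewrite (coefs_eq (has_expansion_starV_lfun (sp11_neq0 A) (ltW (sp11_lt A)))).
Qed.

Lemma psum0 (a : nat -> quat R) (q : qball R) : (q : quat R) = 0 -> psum a q = a 0%N.
Proof.
move=> q0; apply: psum_cvg.
rewrite -(cvg_shiftS (series _)); apply: cvg_near_cst; apply: nearW => n.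
rewrite /series /= big_nat_recl// expr0 mul1r big1 ?addr0//.
by move=> k _; rewrite q0 exprS !mul0r.
Qed.

Lemma moebius0 A (q : qball R) : (q : quat R) = 0 ->
  moebius A q = (A 1 1)^-1 * A 1 0.
Proof.
move=> q0; rewrite moebiusE psum0// /moebius_coef big_ord_recl big_ord0 addr0.
by rewrite /starV_coef expr0 mul1r.
Qed.

Lemma sp11_scalar_subproof u : quat_normsq u = 1 -> sp11_pred (u%:M : 'M[quat R]_2).
Proof.
move=> u1; rewrite /sp11_pred; apply/eqP.
apply: mx2P; rewrite !mulmx2E !I11E !adjmxE !mxE /= ?quat_conj0;
  by rewrite !(mulr1, mulr0, mul0r, addr0, add0r) ?mulrN1 ?mulNr ?quat_mulCx ?u1 ?scale1r.
Qed.

Definition sp11_scalar u (u1 : quat_normsq u = 1) : sp11 R :=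
  Sp11 (sp11_scalar_subproof u1).

(** In the convolution giving the coefficients of F_(u A), the left factor
acquires u^-1 on its right and the right factor acquires u on its left. *)
Lemma moebius_scalar_mull u (u1 : quat_normsq u = 1) A :
  moebius (sp11_mul (sp11_scalar u1) A) = moebius A.
Proof.
have uU : u \is a GRing.unit.
  apply/eqP => u0; move/eqP: u1; rewrite u0 /quat_normsq /= !expr0n /= !addr0.
  by rewrite eq_sym oner_eq0.
have dU : A 1 1 \is a GRing.unit := sp11_neq0 A.
rewrite !moebiusE; congr psum; apply/funext => n; apply: eq_bigr => k _.
have scalE i j : sp11_mul (sp11_scalar u1) A i j = u * A i j.
  by rewrite /= mul_scalar_mx mxE.
rewrite !scalE.
have -> : starV_coef (u * A 0 1) (u * A 1 1) k = starV_coef (A 0 1) (A 1 1) k * u^-1.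
  by rewrite /starV_coef invrM// -!mulrA mulKr.
have -> : lcoef (u * A 0 0) (u * A 1 0) (n - k) = u * lcoef (A 0 0) (A 1 0) (n - k).
  by case: (n - k)%N => [|[|m]] //=; rewrite mulr0.
by rewrite -mulrA mulKr.
Qed.

(** A hyperbolic element with a = d = cosh s, c = sinh s i and b = - sinh s i,
for cosh s = 5/4, sinh s = 3/4: rational, with d^-1 b not real. *)
Definition boost_mx : 'M[quat R]_2 :=
  \matrix_(i, j) if i == j then Quat (5 / 4) 0 0 0
                 else Quat 0 (if i == 0 then 3 / 4 else - (3 / 4)) 0 0.

Lemma boost_subproof : sp11_pred boost_mx.
Proof.
apply/eqP; apply: mx2P; rewrite !mulmx2E !I11E !adjmxE !mxE /=;
  by congr Quat => /=; lra.
Qed.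

Definition boost : sp11 R := Sp11 boost_subproof.

Definition quat_j : quat R := Quat 0 0 1 0.

Lemma quat_j_normsq : quat_normsq quat_j = 1.
Proof. by rewrite /quat_normsq /= expr1n !expr0n !add0r addr0. Qed.

(** At q = 0 the two sides are j^-1 (-(3/5) i) j = (3/5) i and -(3/5) i. *)
Lemma moebius_boost_mulr :
  moebius (sp11_mul boost (sp11_scalar quat_j_normsq)) <> moebius boost.
Proof.
have q0 : `|0 : quat R| < 1 by rewrite normr0.
move=> /(congr1 (@^~ (QBall q0))); rewrite !moebius0//.
rewrite /= !mulmx2E !mxE /= !(mulr0, add0r, addr0) !mulr1n.
move=> /(congr1 (@qi R)) /=.
rewrite quat_normsqM quat_j_normsq mulr1.
have : 0 < (quat_normsq (Quat (5 / 4 : R) 0 0 0))^-1.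
  by rewrite invr_gt0 /quat_normsq /= expr0n !addr0 exprn_gt0//; lra.
by set m := _^-1 => m0; lra.
Qed.

End Moebius.

(** * Non-existence of a compatible group structure *)

Theorem corollary4p1p4 (R : realType) :
  ~ exists s : group_structure (moebius_set R),
      let H : groupType := Group.Pack s in
      @is_hom (sp11 R) H (@to_moebius_set R) \/
      @is_antihom (sp11 R) H (@to_moebius_set R).
Proof.
move=> [s homF]; apply: (@moebius_boost_mulr R).
set N := sp11_scalar (quat_j_normsq R).
have FN : to_moebius_set N = to_moebius_set 1%g.
  apply: eq_exist; rewrite -[N]mulg1; exact: moebius_scalar_mull.
suff FAN : to_moebius_set (boost R * N)%g = to_moebius_set (boost R).
  exact: (congr1 sval FAN).
rewrite -[in RHS](mulg1 (boost R)).
by case: homF => homF; rewrite !homF FN.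
Qed.
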